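(* Let $\beta>1$ with eventually periodic generating sequence $g(\beta)$, let $(F_\beta,\mathcal{L}_\beta)$ be the right Fischer cover of the beta-shift $\mathsf{X}_\beta$, and let $\pi\colon\mathsf{X}_{F_\beta}\to\mathsf{X}_\beta$ be the covering map. If $g(\beta)$ is periodic, then $\pi$ is $1$ to $1$, and if not, then it is $2$ to $1$.
   Context: Let $\beta>1$. For $t\in[0,1]$ put $r_1(t)=\langle\beta t\rangle$, $x_1(t)=\lfloor\beta t\rfloor$, $r_n(t)=\langle\beta r_{n-1}(t)\rangle$, $x_n(t)=\lfloor\beta r_{n-1}(t)\rfloor$ ($\lfloor\cdot\rfloor$ integer part, $\langle\cdot\rangle$ fractional part). The sequence $x_1(t)x_2(t)\cdots$ is the $\beta$-expansion of $t$, and $e(\beta)$ is the $\beta$-expansion of $1$; it is finite if its terms are eventually $0$. The generating sequence is $g(\beta)=e(\beta)$ if $e(\beta)$ is not finite, and $g(\beta)=(a_1\cdots a_{k-1}(a_k-1))^\infty$ if $e(\beta)=a_1\cdots a_k00\cdots$ with $a_k\ne0$. The beta-shift $\mathsf{X}_\beta$ is the two-sided shift space whose language is the set of finite factors of $\beta$-expansions of $t\in[0,1)$; equivalently (Rényi) it consists of the $x\in\{0,\ldots,\lceil\beta\rceil-1\}^{\mathbb{Z}}$ with $x_kx_{k+1}\cdots\le g(\beta)$ lexicographically for all $k\in\mathbb{Z}$. It is irreducible, and it is sofic exactly when $g(\beta)$ is eventually periodic. A presentation of a shift space $X$ is a labelled graph whose biinfinite paths have label sequences exactly the elements of $X$;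 it is right-resolving if no vertex emits two edges with the same label. The right Fischer cover of an irreducible sofic shift is its right-resolving presentation with the minimal number of vertices, unique up to isomorphism. $\mathsf{X}_{F_\beta}$ is the edge shift of biinfinite paths in $F_\beta$ and the covering map sends a path $(e_i)_i$ to $(\mathcal{L}_\beta(e_i))_i$. The covering map $\pi$ is said to be $m$ to $1$ if $\sup\{|\pi^{-1}(x)|\mid x\in\mathsf{X}_\beta\}=m$. *)

(* Defs.v *)
From HB Require Import structures.
From mathcomp Require Import all_boot all_order all_algebra.
From mathcomp Require Import all_classical all_reals all_analysis.

Set Implicit Arguments.
Unset Strict Implicit.
Unset Printing Implicit Defensive.

Import Order.TTheory GRing.Theory Num.Theory.
Local Open Scope classical_set_scope.
Local Open Scope ring_scope.

Section BetaExpansion.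
Variable R : realType.
Implicit Types beta t : R.

Definition frac_part (y : R) : R := y - (Num.floor y)%:~R.

(* [beta_rem beta t n] is $r_n(t)$, with $r_0(t) = t$. *)
Fixpoint beta_rem beta t (n : nat) : R :=
  if n is n'.+1 then frac_part (beta * beta_rem beta t n') else t.

(* Digits are numbered from 0: [beta_expansion beta t n] is $x_{n+1}(t)$.
   [Num.truncn] is the integer part with values in [nat]; it agrees with
   [Num.floor] here because $\beta r_n(t) \ge 0$ for $\beta > 1$ and
   $t \in [0,1]$. *)
Definition beta_expansion beta t : nat -> nat :=
  fun n => Num.truncn (beta * beta_rem beta t n).

Definition vanishes_from (u : nat -> nat) (k : nat) : Prop :=
  forall n, (k <= n)%N -> u n = 0%N.

Lemma finite_seqP (u : nat -> nat) :
  (exists k, vanishes_from u k) -> exists k, `[< vanishes_from u k >].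
Proof. by case=> k uk; exists k; apply/asboolP. Qed.

(* The least [k] with $u_n = 0$ for all $n \ge k$: when [k > 0], $u_{k-1}$ is
   the last nonzero term. *)
Definition finite_length (u : nat -> nat)
  (fu : exists k, vanishes_from u k) : nat := ex_minn (finite_seqP fu).

(* In the finite case $k > 0$, since the leading digit $\lfloor\beta\rfloor$
   of [beta_expansion beta 1] is positive when $\beta > 1$. *)
Definition generating_seq beta : nat -> nat :=
  let e := beta_expansion beta 1 in
  match pselect (exists k, vanishes_from e k) with
  | left fe => let k := finite_length fe in
      fun n => if (n %% k)%N == k.-1 then (e k.-1).-1 else e (n %% k)%N
  | right _ => e
  end.

End BetaExpansion.

Definition periodic_seq (u : nat -> nat) : Prop :=
  exists2 p, (0 < p)%N & forall n, u (n + p)%N = u n.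

Definition eventually_periodic_seq (u : nat -> nat) : Prop :=
  exists N, exists2 p, (0 < p)%N & forall n, (N <= n)%N -> u (n + p)%N = u n.

Definition factors (A : Type) (u : nat -> A) : set (seq A) :=
  [set w | exists k n, w = [seq u (k + i)%N | i <- iota 0 n]].

Definition bifactors (A : Type) (x : int -> A) : set (seq A) :=
  [set w | exists (k : int) n, w = [seq x (k + i%:Z) | i <- iota 0 n]].

Definition beta_language (R : realType) (beta : R) : set (seq nat) :=
  [set w | exists2 t : R, 0 <= t < 1 & factors (beta_expansion beta t) w].

(* A shift space is the set of all biinfinite sequences whose finite factors
   belong to its language.  The alphabet $\{0,\ldots,\lceil\beta\rceil-1\}$ is
   embedded in [nat]; the digits of $\beta$-expansions of points of $[0,1)$
   automatically lie in it. *)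
Definition beta_shift (R : realType) (beta : R) : set (int -> nat) :=
  [set x | bifactors x `<=` beta_language beta].

Record lgraph (A : Type) := LGraph {
  vertex : finType;
  edge : finType;
  src : edge -> vertex;
  tgt : edge -> vertex;
  lab : edge -> A
}.

Section LabelledGraph.
Variable A : Type.
Implicit Types (G : lgraph A) (X : set (int -> A)).

Definition edge_shift G : set (int -> edge G) :=
  [set e | forall i, tgt (e i) = src (e (i + 1))].
Arguments edge_shift : clear implicits.

Definition covering_map G (e : int -> edge G) : int -> A := fun i => lab (e i).
Arguments covering_map : clear implicits.

Definition presents G X : Prop := covering_map G @` edge_shift G = X.

Definition right_resolving G : Prop :=
  forall e f : edge G, src e = src f -> lab e = lab f -> e = f.

Definition right_Fischer_cover G X : Prop :=
  [/\ presents G X, right_resolving G &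
      forall H : lgraph A, presents H X -> right_resolving H ->
        (#|vertex G| <= #|vertex H|)%N].

End LabelledGraph.

Arguments edge_shift {A} G _.
Arguments covering_map {A} G e i.

(* [f], as a map from [D] to [X], is m to 1: the supremum of the cardinalities
   of its fibers is m.  The cardinality [counting] takes values in the extended
   reals and is [+oo] on infinite sets. *)
Definition m_to_one (R : realType) (T : choiceType) (U : Type)
    (f : T -> U) (D : set T) (X : set U) (m : nat) : Prop :=
  ereal_sup [set (counting (D `&` f @^-1` [set x]) : \bar R) | x in X]
    = m%:R%:E.

(* Main.v *)
(** The points of [0,1) whose expansion starts with a word w are mapped by the
    |w|-th remainder onto an interval [0, r), and reading a further digit a
    replaces r by min(1, beta r - a).  Hence w is in the language iff r > 0, and
    the positive values of r are the points of the orbit of 1 under the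
    quasi-greedy map, whose digits form g(beta).  When g(beta) is eventually
    periodic this orbit is finite; it carries a right-resolving presentation,
    and its points have pairwise distinct follower sets.  Some vertex of any
    right-resolving presentation has the whole language as follower set, so
    every point of the orbit is matched by a vertex, and by minimality the
    Fischer cover is this graph.

    A fiber then consists of the sequences of states s with
    s_(i+1) = min(1, beta s_i - x_i).  Two of them that visit 1 infinitely often
    in the past coincide, by monotonicity; two of them that do not coincide as
    well, since the dynamics is then expanding and the states are finitely many.
    So fibers have at most two points.  If g(beta) is periodic every sequence
    visits 1 infinitely often in the past; otherwise the biinfinite periodic
    sequence obtained from the tail of g(beta) carries a sequence avoiding 1,
    and the largest sequence of states lies strictly above it. *)
Require Import Defs.
From mathcomp Require Import all_boot all_order all_algebra.
From mathcomp Require Import all_classical all_reals all_analysis.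
From mathcomp Require Import zify ring lra.
Local Open Scope ring_scope.

Set Implicit Arguments.
Unset Strict Implicit.
Unset Printing Implicit Defensive.
Import Order.TTheory GRing.Theory Num.Theory.

(** * Greedy steps and the quasi-greedy orbit of 1 *)

Section Dynamics.
Variables (R : realType) (beta : R).
Hypothesis beta_gt1 : 1 < beta.

(* If the points of [0, r) are the possible remainders, reading the digit [a]
   leaves exactly those of [0, step r a). *)
Definition step (r : R) (a : nat) : R := Num.min 1 (beta * r - a%:R).

Definition run : R -> seq nat -> R := foldl step.

(* Greatest digit strictly below [beta * r]: the quasi-greedy digit. *)
Definition qdigit (r : R) : nat := `|Num.ceil (beta * r)|%N.-1.

Definition qstep (r : R) : R := beta * r - (qdigit r)%:R.

Definition qdigits (r : R) (n : nat) : seq nat :=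
  [seq qdigit (iter i qstep r) | i <- iota 0 n].

Definition orb (n : nat) : R := iter n qstep 1.

Let beta_gt0 : 0 < beta.
Proof. exact: lt_trans beta_gt1. Qed.

Lemma step_le1 r a : step r a <= 1.
Proof. by rewrite /step ge_min lexx. Qed.

Lemma step_le r r' a : r <= r' -> step r a <= step r' a.
Proof.
move=> rr'; rewrite /step le_min ge_min lexx /=.
by rewrite ge_min lerD2r ler_pM2l // rr' orbT.
Qed.

Lemma step_le0 r a : r <= 0 -> step r a <= 0.
Proof.
move=> r0; rewrite /step ge_min; apply/orP; right.
have : beta * r <= 0 by rewrite pmulr_rle0.
have : 0 <= a%:R :> R by [].
lra.
Qed.

Lemma step_lt1E r a : step r a < 1 -> step r a = beta * r - a%:R.
Proof. by rewrite /step minEle; case: ifP => //; rewrite ltxx. Qed.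

Lemma run_cat r u v : run r (u ++ v) = run (run r u) v.
Proof. exact: foldl_cat. Qed.

Lemma run_rcons r u a : run r (rcons u a) = step (run r u) a.
Proof. by rewrite -cats1 run_cat. Qed.

Lemma run_le1 r w : r <= 1 -> run r w <= 1.
Proof. by elim/last_ind: w => // w a _ _; rewrite run_rcons step_le1. Qed.

Lemma run_le r r' w : r <= r' -> run r w <= run r' w.
Proof. by elim: w r r' => //= a w IH r r' rr'; apply/IH/step_le. Qed.

Lemma run_le0 r w : r <= 0 -> run r w <= 0.
Proof. by elim: w r => //= a w IH r r0; apply/IH/step_le0. Qed.

Lemma run_gt0 r w : 0 < run r w -> 0 < r.
Proof. by rewrite !ltNge; apply: contra; exact: run_le0. Qed.

Lemma run_gt0_catl r u v : 0 < run r (u ++ v) -> 0 < run r u.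
Proof. by rewrite run_cat; exact: run_gt0. Qed.

Lemma qdigit_itv r : 0 < r -> (qdigit r)%:R < beta * r <= (qdigit r).+1%:R.
Proof.
move=> r0; have br0 : 0 < beta * r by rewrite mulr_gt0.
have c0 : (0 < Num.ceil (beta * r)) by rewrite ceil_gt0.
have [n En] : exists n : nat, Num.ceil (beta * r) = n.+1%:Z.
  by exists (`|Num.ceil (beta * r)|%N.-1); lia.
have := ceil_itv (beta * r).
by rewrite /qdigit En /= intrD -!pmulrn -natr1 addrK.
Qed.

Lemma qstep_gt0 r : 0 < r -> 0 < qstep r.
Proof. by move=> /qdigit_itv/andP[h _]; rewrite subr_gt0. Qed.

Lemma qstep_le1 r : 0 < r -> qstep r <= 1.
Proof. by move=> /qdigit_itv/andP[_]; rewrite lerBlDr addrC natr1. Qed.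

Lemma step_qdigit r : 0 < r -> step r (qdigit r) = qstep r.
Proof. by move=> r0; apply/min_idPr/qstep_le1. Qed.

(** A digit below the quasi-greedy one leaves at least 1 and is cut down to 1; a digit above it
    leaves nothing positive. *)
Lemma step_gt0P r a : 0 < r -> 0 < step r a ->
  step r a = 1 \/ a = qdigit r /\ step r a = qstep r.
Proof.
move=> r0; have /andP[dlt dle] := qdigit_itv r0.
case: (ltngtP a (qdigit r)) => [ad|ad|->].
- move=> _; left; apply/min_idPl.
  have : a.+1%:R <= (qdigit r)%:R :> R by rewrite ler_nat.
  by rewrite -natr1; lra.
- have : (qdigit r).+1%:R <= a%:R :> R by rewrite ler_nat.
  by rewrite /step lt_min; move=> ? /andP[_]; lra.
- by move=> _; right; rewrite step_qdigit.
Qed.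

Lemma step_lt1_qstep r a : 0 < r -> 0 < step r a -> step r a < 1 ->
  step r a = qstep r.
Proof. by move=> r0 s0; case: (step_gt0P r0 s0) => [->|[_ ->]] //; rewrite ltxx. Qed.

Lemma iter_qstep_gt0 n r : 0 < r -> 0 < iter n qstep r.
Proof. by move=> r0; elim: n => //= n; exact: qstep_gt0. Qed.

Lemma orb_gt0 n : 0 < orb n.
Proof. exact: iter_qstep_gt0. Qed.

Lemma orb_le1 n : orb n <= 1.
Proof. by case: n => // n; apply: qstep_le1; exact: orb_gt0. Qed.

Lemma orbD m n : orb (m + n) = iter m qstep (orb n).
Proof. exact: iterD. Qed.

(** Each digit either resets the state to 1, the start of the orbit, or advances it by one
    quasi-greedy step. *)
Lemma run_orb n w : 0 < run (orb n) w -> exists m, run (orb n) w = orb m.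
Proof.
elim/last_ind: w => [|w a IH]; first by exists n.
rewrite run_rcons => s0.
have r0 : 0 < run (orb n) w.
  by move: s0; rewrite !ltNge; apply: contra; exact: step_le0.
have [m Em] := IH r0.
case: (step_gt0P r0 s0) => [->|[_ ->]]; first by exists 0%N.
by exists m.+1; rewrite Em.
Qed.

Lemma qdigitsS r n : qdigits r n.+1 = rcons (qdigits r n) (qdigit (iter n qstep r)).
Proof. by rewrite /qdigits -addn1 iotaD map_cat /= cats1. Qed.

Lemma run_qdigits r n : 0 < r -> run r (qdigits r n) = iter n qstep r.
Proof.
by move=> r0; elim: n => // n IH; rewrite qdigitsS run_rcons IH step_qdigit // iter_qstep_gt0.
Qed.

Lemma ltr_exp_unbounded (c : R) : exists n, c < beta ^+ n.
Proof.
have [n cn] : exists n : nat, c / (beta - 1) < n%:R.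
  by exists (Num.bound `|c / (beta - 1)|); apply: le_lt_trans (archi_boundP _); rewrite ?ler_norm.
exists n; move: cn; rewrite ltr_pdivrMr ?subr_gt0 // => /lt_le_trans; apply.
elim: n => [|n IH]; first by rewrite mul0r.
have b1 : 1 <= beta ^+ n by rewrite exprn_ege1 // ltW.
rewrite -natr1 exprS mulrDl mul1r.
have : 0 <= (beta - 1) * (beta ^+ n - 1) by rewrite mulr_ge0 // subr_ge0 // ltW.
lra.
Qed.

(** Each affine step multiplies the gap to the orbit of [r'] by [beta], and the cut at 1 can only
    lower the run. *)
Lemma run_le_expansion r r' n : 0 < r' ->
  run r (qdigits r' n) <= iter n qstep r' - beta ^+ n * (r' - r).
Proof.
move=> r0; elim: n => [|n IH]; first by rewrite /= expr0 mul1r; lra.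
rewrite qdigitsS run_rcons iterS {2}/qstep exprS.
have /le_trans : step (run r (qdigits r' n)) (qdigit (iter n qstep r')) <=
  beta * run r (qdigits r' n) - (qdigit (iter n qstep r'))%:R by rewrite ge_min lexx orbT.
apply; move: IH; rewrite -(ler_pM2l beta_gt0); lra.
Qed.

(** The gap grows like [beta ^+ n] while the iterates of [r'] stay bounded by [Num.max 1 r']. *)
Lemma run_qdigits_le0 r r' : r < r' -> 0 < r' -> exists n, run r (qdigits r' n) <= 0.
Proof.
move=> rr' r0; have [n nP] := ltr_exp_unbounded (Num.max 1 r' / (r' - r)).
exists n; apply: le_trans (run_le_expansion _ _ r0) _.
move: nP; rewrite ltr_pdivrMr ?subr_gt0 // => nP.
suff : iter n qstep r' <= Num.max 1 r' by lra.
rewrite le_max; case: n {nP} => [|n]; first by rewrite lexx orbT.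
by rewrite qstep_le1 // iter_qstep_gt0.
Qed.

(** The digits of the larger point eventually kill the smaller one, whereas a point always survives
    its own digits. *)
Lemma qdigit_inj r r' : 0 < r -> 0 < r' ->
  (forall n, qdigit (iter n qstep r) = qdigit (iter n qstep r')) -> r = r'.
Proof.
wlog rr' : r r' / r < r' => [hw r0 r'0 E|r0 r'0 E].
  by case: (ltgtP r r') => // h; [exact: hw|apply/esym/hw].
have [n] := run_qdigits_le0 rr' r'0.
have -> : qdigits r' n = qdigits r n by apply: eq_map => i; rewrite E.
by rewrite run_qdigits // leNgt iter_qstep_gt0.
Qed.

Lemma separating_word r r' : 0 < r -> 0 < r' ->
  (forall w, 0 < run r w <-> 0 < run r' w) -> r = r'.
Proof.
wlog rr' : r r' / r < r' => [hw r0 r'0 E|r0 r'0 E].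
  case: (ltgtP r r') => // h; [exact: hw|apply/esym/hw => // w].
  by split => /E.
have [n] := run_qdigits_le0 rr' r'0.
by rewrite leNgt => /negP[]; apply/E; rewrite run_qdigits // iter_qstep_gt0.
Qed.

(** Zeros multiply the state by [beta] until the cut at 1 takes effect, and then leave it at 1. This
    gives a way back to 1 from every state. *)
Lemma run_nseq0 r : 0 < r <= 1 -> exists n, run r (nseq n 0%N) = 1.
Proof.
move=> /andP[r0 r1]; have [n nP] := ltr_exp_unbounded r^-1.
exists n; suff -> : run r (nseq n 0%N) = Num.min 1 (beta ^+ n * r).
  by apply/min_idPl/ltW; rewrite -ltr_pdivrMr // mul1r.
elim: n {nP} => [|n IH]; first by rewrite expr0 mul1r /=; apply/esym/min_idPr.
rewrite -[n.+1]addn1 nseqD run_cat IH /= /step subr0 addn1 exprS -mulrA.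
have : 0 <= beta ^+ n * r by rewrite mulr_ge0 ?exprn_ge0 // ltW.
case: (leP 1 (beta ^+ n * r)) => // h h0; rewrite mulr1.
have b1 := ltW beta_gt1.
by rewrite !(min_idPl _) // (le_trans b1) // ler_peMr // ltW.
Qed.

Lemma run_nseq0_gt0 r n : 0 < r -> 0 < run r (nseq n 0%N).
Proof.
elim: n r => //= n IH r r0; apply: IH.
by rewrite /step subr0 lt_min ltr01 mulr_gt0.
Qed.

End Dynamics.

(** * Beta-expansions, the generating sequence and the language *)

Section Expansions.
Variables (R : realType) (beta : R).
Hypothesis beta_gt1 : 1 < beta.

Let beta_gt0 : 0 < beta.
Proof. exact: lt_trans beta_gt1. Qed.

Local Notation e := (beta_expansion beta).

Lemma frac_part_truncn (y : R) : 0 <= y -> frac_part y = y - (Num.truncn y)%:R.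
Proof.
move=> y0; rewrite /frac_part (@floor_def _ y (Num.truncn y)) //.
by rewrite intrD -!pmulrn natr1 truncn_itv.
Qed.

Lemma frac_part_itv (y : R) : 0 <= frac_part y < 1.
Proof. by have := floor_itv y; rewrite /frac_part intrD; lra. Qed.

(** The greedy and quasi-greedy maps differ only where [beta * r] is an integer. *)
Lemma qstep_frac_part r : 0 < r -> 0 < frac_part (beta * r) ->
  Num.truncn (beta * r) = qdigit beta r /\ frac_part (beta * r) = qstep beta r.
Proof.
move=> r0; have br0 : 0 <= beta * r by rewrite mulr_ge0 // ltW.
rewrite frac_part_truncn // subr_gt0 => tlt.
suff Ed : Num.truncn (beta * r) = qdigit beta r by rewrite /qstep Ed.
have /andP[h1 h2] := qdigit_itv beta_gt1 r0; have /andP[_ h3] := truncn_itv br0.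
have : (Num.truncn (beta * r))%:R < (qdigit beta r).+1%:R :> R by lra.
have : (qdigit beta r)%:R < (Num.truncn (beta * r)).+1%:R :> R by lra.
rewrite !ltr_nat; lia.
Qed.

(** Here the quasi-greedy digit is one less and the remainder is 1 instead of 0: this is the change
    made to the last nonzero digit of a finite expansion of 1. *)
Lemma qstep_frac_part0 r : 0 < r -> frac_part (beta * r) = 0 ->
  (Num.truncn (beta * r)).-1 = qdigit beta r /\ qstep beta r = 1.
Proof.
move=> r0; have br0 : 0 < beta * r by rewrite mulr_gt0.
rewrite frac_part_truncn ?(ltW br0) // => /eqP; rewrite subr_eq0 => /eqP tE.
have /andP[h1 h2] := qdigit_itv beta_gt1 r0.
suff Ed : Num.truncn (beta * r) = (qdigit beta r).+1.
  by rewrite Ed /qstep tE Ed -natr1; split=> //; lra.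
move: h1 h2; rewrite {1}tE {2}tE ltr_nat ler_nat; lia.
Qed.

Lemma beta_rem_itv t n : 0 <= t <= 1 -> 0 <= beta_rem beta t n <= 1.
Proof.
case: n => //= n _; have /andP[-> /ltW] := frac_part_itv (beta * beta_rem beta t n).
by [].
Qed.

Lemma beta_rem_vanishes n : beta_rem beta 1 n = 0 -> vanishes_from (e 1) n.
Proof.
move=> r0 m /subnKC <-; rewrite /beta_expansion.
suff -> : beta_rem beta 1 (n + (m - n)) = 0 by rewrite mulr0 truncn0.
elim: (m - n)%N => [|k IH]; first by rewrite addn0.
by rewrite addnS /= IH mulr0 /frac_part floor0 subr0.
Qed.

(** Under zero digits the remainder is multiplied by [beta] at each step, so a positive one would
    exceed 1. *)
Lemma vanishes_beta_rem n : vanishes_from (e 1) n -> beta_rem beta 1 n = 0.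
Proof.
move=> en; apply/eqP; rewrite eq_le.
have itv k : 0 <= beta_rem beta 1 k <= 1 by apply: beta_rem_itv; rewrite ler01 lexx.
have /andP[-> _] := itv n; rewrite andbT leNgt; apply/negP => r0.
have [k] := ltr_exp_unbounded beta_gt1 (beta_rem beta 1 n)^-1.
rewrite -(ltr_pM2r r0) mulVf ?gt_eqF // ltNge => /negP; apply.
suff <- : beta_rem beta 1 (n + k) = beta ^+ k * beta_rem beta 1 n.
  by have /andP[] := itv (n + k)%N.
elim: k => [|k IH]; first by rewrite addn0 mul1r.
have := en (n + k)%N (leq_addr _ _); rewrite /beta_expansion => tE.
rewrite addnS /= frac_part_truncn ?mulr_ge0 ?(ltW beta_gt0) //.
  by rewrite tE subr0 IH exprS mulrA.
by have /andP[] := itv (n + k)%N.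
Qed.

Lemma generating_seqE n : generating_seq beta n = qdigit beta (orb beta n).
Proof.
have rem_ge0 k : 0 <= beta_rem beta 1 k.
  by have /andP[] : 0 <= beta_rem beta 1 k <= 1 by apply: beta_rem_itv; rewrite ler01 lexx.
have remE k : (forall j, (j <= k)%N -> 0 < beta_rem beta 1 j) -> orb beta k = beta_rem beta 1 k.
  elim: k => // k IH pos; rewrite /orb iterS -/(orb beta k) IH; last first.
    by move=> j jk; apply: pos; exact: leqW.
  by have [_ <-] := qstep_frac_part (pos k (leqnSn k)) (pos k.+1 (leqnn _)).
rewrite /generating_seq; case: pselect => [fe|nfe]; last first.
  have pos k : 0 < beta_rem beta 1 k.
    rewrite lt_neqAle rem_ge0 andbT eq_sym; apply/eqP => /beta_rem_vanishes ?.
    by apply: nfe; exists k.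
  rewrite remE //.
  by have [<- _] := qstep_frac_part (pos n) (pos n.+1).
rewrite /finite_length; case: ex_minnP => k /asboolP vk kmin.
have pos j : (j < k)%N -> 0 < beta_rem beta 1 j.
  move=> jk; rewrite lt_neqAle rem_ge0 andbT eq_sym; apply/eqP => /beta_rem_vanishes ?.
  by move: jk; rewrite ltnNge => /negP; apply; apply/kmin/asboolP.
have rk := vanishes_beta_rem vk.
have k0 : (0 < k)%N by case: k rk {vk kmin pos} => //= /eqP; rewrite oner_eq0.
have orbE j : (j < k)%N -> orb beta j = beta_rem beta 1 j.
  by move=> jk; apply: remE => i ij; apply/pos/(leq_ltn_trans ij).
have k1 : (k.-1 < k)%N by rewrite prednK.
have rk1 : frac_part (beta * beta_rem beta 1 k.-1) = 0 by rewrite -rk -{2}(prednK k0).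
have [dE qE] := qstep_frac_part0 (pos _ k1) rk1.
(* The expansion ends exactly at [k], where the quasi-greedy orbit returns to 1; hence it is
   periodic with period [k], as the generating sequence is. *)
have orbk : orb beta k = 1.
  by rewrite -(prednK k0) /orb iterS -/(orb beta k.-1) orbE.
have orb_mod m : orb beta m = orb beta (m %% k).
  rewrite {1}(divn_eq m k) addnC orbD; congr iter.
  by elim: (m %/ k)%N => // q IH; rewrite mulSn addnC orbD orbk.
rewrite orb_mod; have nk : (n %% k < k)%N by rewrite ltn_mod.
rewrite orbE //; case: eqP => [->|/eqP neq]; first by rewrite -dE.
have lt1 : ((n %% k).+1 < k)%N by rewrite ltn_neqAle nk andbT; move: neq; rewrite -(eqn_add2r 1) !addn1 prednK.
by have [<- _] := qstep_frac_part (pos _ nk) (pos _ lt1).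
Qed.

(** A point of the orbit is determined by its quasi-greedy digits, so periodicity passes from digits
    to points. *)
Lemma orb_eventually_periodic N p :
  (forall n, (N <= n)%N -> generating_seq beta (n + p)%N = generating_seq beta n) ->
  forall n, (N <= n)%N -> orb beta (n + p) = orb beta n.
Proof.
move=> gp n Nn; apply: (qdigit_inj beta_gt1); rewrite ?orb_gt0 // => k.
rewrite -!orbD -!generating_seqE addnA gp //.
exact: leq_trans Nn (leq_addl _ _).
Qed.

Lemma beta_remD t m n : beta_rem beta t (m + n) = beta_rem beta (beta_rem beta t m) n.
Proof. by elim: n => [|n IH]; rewrite ?addn0 // addnS /= IH. Qed.

(** The bound [r] is kept general for the induction: after the digit [a], the remainders of the
    points below [r] fill the interval from 0 to [step r a]. *)
Lemma cylinder_run r w : r <= 1 ->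
  (exists2 t, 0 <= t < 1 & t < r /\ w = [seq e t i | i <- iota 0 (size w)]) <->
  0 < run beta r w.
Proof.
elim: w r => [|a w IH] r r1 /=.
  split=> [[t /andP[t0 _] [tr _]]|r0]; first exact: le_lt_trans tr.
  by exists 0 => //; rewrite lexx ltr01.
split.
- move=> [t /andP[t0 t1] [tr [aE wE]]]; apply/(IH _ (step_le1 _ _ _)).
  have bt0 : 0 <= beta * t by rewrite mulr_ge0 // ltW.
  exists (beta_rem beta t 1); first exact: frac_part_itv.
  split.
    rewrite lt_min /=; have /andP[_ ->] := frac_part_itv (beta * t).
    by rewrite frac_part_truncn // aE ltrD2r ltr_pM2l.
  rewrite {1}wE (iotaDl 1 0) -map_comp; apply: eq_map => i /=.
  by rewrite /beta_expansion beta_remD.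
- move=> /(IH _ (step_le1 _ _ _))[s /andP[s0 s1] [sr wE]].
  (* The witness is the preimage of [s] under the branch of digit [a]. *)
  have tE : beta * ((a%:R + s) / beta) = a%:R + s by rewrite mulrCA mulfV ?gt_eqF // mulr1.
  have trE : Num.truncn (a%:R + s) = a by apply: truncn_def; rewrite -natr1; lra.
  have rE : beta_rem beta ((a%:R + s) / beta) 1 = s.
    by rewrite /= tE frac_part_truncn ?addr_ge0 // trE; lra.
  have tr : (a%:R + s) / beta < r.
    by rewrite ltr_pdivrMr //; move: sr; rewrite lt_min => /andP[_]; lra.
  exists ((a%:R + s) / beta).
    by rewrite (lt_le_trans tr) // divr_ge0 ?addr_ge0 // ltW.
  split=> //; rewrite {1}/beta_expansion [beta_rem _ _ 0]/= tE trE; congr cons.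
  rewrite {1}wE (iotaDl 1 0) -map_comp; apply: eq_map => i /=.
  by rewrite /beta_expansion beta_remD rE.
Qed.

(** A factor at position [k] is a prefix of the expansion of the [k]-th remainder, again a point of
    [0,1). *)
Lemma beta_languageE w : beta_language beta w <-> 0 < run beta 1 w.
Proof.
rewrite -(cylinder_run w (lexx 1)); split.
- move=> [t /andP[t0 t1] [k [n ->]]]; exists (beta_rem beta t k).
    by case: k => [|k]; [rewrite t0|exact: frac_part_itv].
  split; first by case: k => [|k] //; have /andP[] := frac_part_itv (beta * beta_rem beta t k).
  rewrite size_map size_iota; apply: eq_map => i.
  by rewrite /beta_expansion beta_remD.
- by move=> [t t01 [_ ->]]; exists t => //; exists 0%N, (size w).
Qed.

End Expansions.

(** * Finite words of biinfinite sequences *)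

Section Words.
Variable A : Type.
Implicit Types (x : int -> A) (i : int).

Definition word x i n : seq A := [seq x (i + j%:Z) | j <- iota 0 n].

Lemma wordD x i m n : word x i (m + n) = word x i m ++ word x (i + m%:Z) n.
Proof.
rewrite /word iotaD map_cat add0n -[m in iota m n]addn0 iotaDl -map_comp.
by congr (_ ++ _); apply: eq_map => j /=; rewrite PoszD addrA.
Qed.

Lemma word1 x i : word x i 1 = [:: x i].
Proof. by rewrite /word /= addr0. Qed.

Lemma wordS x i n : word x i n.+1 = rcons (word x i n) (x (i + n%:Z)).
Proof. by rewrite -addn1 wordD word1 cats1. Qed.

Lemma word_cons x i n : word x i n.+1 = x i :: word x (i + 1) n.
Proof. by rewrite -[n.+1]add1n wordD word1. Qed.

End Words.

(** By induction on the number of entries of [V] below the current value, which drops at each strict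
    decrease. *)
Lemma nonincreasing_finite_stable (R : realType) (V : seq R) (u : nat -> R) :
  (forall n, u n \in V) -> (forall n, u n.+1 <= u n) ->
  exists m, forall n, (m <= n)%N -> u n = u m.
Proof.
move=> uV uS.
have mono m n : (m <= n)%N -> u n <= u m.
  by move=> /subnKC <-; elim: (n - m)%N => [|k IH]; rewrite ?addn0 // addnS (le_trans (uS _)).
suff H k m : (count (fun v => (v < u m)%R) V <= k)%N -> exists m, forall n, (m <= n)%N -> u n = u m.
  exact: (H _ 0%N (leqnn _)).
elim: k m => [|k IH] m.
  rewrite leqNgt -has_count -all_predC => /allP um; exists m => n mn.
  apply/eqP; rewrite eq_le mono //= leNgt.
  exact: um (uV n).
move=> cm; have [st|nst] := pselect (forall n, (m <= n)%N -> u n = u m); first by exists m.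
have [n un] : exists n, u n < u m.
  apply: contrapT => nlt; apply: nst => n mn; apply/eqP; rewrite eq_le mono //= leNgt.
  by apply/negP => ?; apply: nlt; exists n.
apply: (IH n); rewrite -ltnS; apply: leq_trans cm.
have cU := count_predUI (fun v => v < u n) (pred1 (u n)) V.
rewrite [X in (_ + X)%N = _](_ : _ = 0%N) ?addn0 in cU; last first.
  rewrite (@eq_count _ _ pred0) ?count_pred0 // => v /=.
  by apply/negbTE/negP => /andP[/[swap] /eqP ->]; rewrite ltxx.
apply: (@leq_trans (count (predU (fun v => (v < u n)%R) (pred1 (u n))) V)).
  by rewrite cU -addn1 leq_add2l -has_count has_pred1.
by apply: sub_count => v /= /orP[/lt_trans -> //|/eqP ->].
Qed.

(** * State sequences and the graph on the orbit *)

Section States.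
Variables (R : realType) (beta : R).
Hypothesis beta_gt1 : 1 < beta.
Variable V : seq R.
Hypothesis orbP : forall r, r \in V <-> exists n, r = orb beta n.

Implicit Types (x : int -> nat) (s : int -> R).

Definition states x s : Prop := forall i, s i \in V /\ s (i + 1) = step beta (s i) (x i).

Lemma state_gt0 r : r \in V -> 0 < r.
Proof. by move=> /orbP[n ->]; exact: orb_gt0. Qed.

Lemma state_le1 r : r \in V -> r <= 1.
Proof. by move=> /orbP[n ->]; exact: orb_le1. Qed.

Lemma state1 : 1 \in V.
Proof. by apply/orbP; exists 0%N. Qed.

Lemma run_state r w : r \in V -> 0 < run beta r w -> run beta r w \in V.
Proof. by move=> /orbP[n ->] /(run_orb beta_gt1) ?; apply/orbP. Qed.

Lemma run_states x s i n : states x s -> run beta (s i) (word x i n) = s (i + n%:Z).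
Proof.
move=> xs; elim: n => [|n IH]; first by rewrite addr0.
by rewrite wordS run_rcons IH -(xs _).2 -addrA -PoszD addn1.
Qed.

Lemma states_beta_shift x s : states x s -> beta_shift beta x.
Proof.
move=> xs w [i [n ->]]; apply/(beta_languageE beta_gt1).
apply: lt_le_trans (run_le beta_gt1 (word x i n) (state_le1 (xs i).1)).
by rewrite run_states // state_gt0 // (xs _).1.
Qed.

Lemma beta_shift_run x i n : beta_shift beta x -> 0 < run beta 1 (word x i n).
Proof. by move=> Xx; apply/(beta_languageE beta_gt1)/Xx; exists i, n. Qed.

(* The largest states compatible with the past of [x]. *)
Lemma exists_max_states x : beta_shift beta x ->
  exists s, states x s /\ forall i, exists m, s i = run beta 1 (word x (i - m%:Z) m).
Proof.
move=> Xx; pose u i m := run beta 1 (word x (i - m%:Z) m).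
have uV i m : u i m \in V by apply: run_state state1 _; exact: beta_shift_run.
have uS i m : u i m.+1 <= u i m.
  rewrite /u word_cons /=.
  have -> : i - m.+1%:Z + 1 = i - m%:Z by lia.
  by apply: run_le => //; exact: step_le1.
have /choice[m mP] i := nonincreasing_finite_stable (uV i) (uS i).
exists (fun i => u i (m i)); split=> i; last by exists (m i).
(* With a past of length [n] at [i] and of length [n.+1] at [i + 1], both limits are attained and
   the two words have the same starting position. *)
split=> //; pose n := maxn (m i) (m (i + 1)).
rewrite -(mP i n) ?leq_maxl // -(mP (i + 1) n.+1) ?(leqW (leq_maxr _ _)) //.
rewrite /u wordS run_rcons.
have -> : i + 1 - n.+1%:Z = i - n%:Z by lia.
by rewrite subrK.
Qed.

(** Bounding the digits makes the edge type finite; nothing is lost, since a digit with a positive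
    step is below [beta]. *)
Let bound := Num.bound beta.

Let state_edge : finType :=
  {e : seq_sub V * 'I_bound * seq_sub V | step beta (val e.1.1) e.1.2 == val e.2}.

Definition state_graph : lgraph nat :=
  @LGraph nat (seq_sub V) state_edge (fun e => (val e).1.1) (fun e => (val e).2)
    (fun e => (val e).1.2).

Lemma state_edge_exists (u v : seq_sub V) a : step beta (val u) a = val v ->
  exists e : edge state_graph, [/\ src e = u, tgt e = v & lab e = a].
Proof.
move=> uav.
have ab : (a < bound)%N.
  have b0 : 0 < beta by exact: lt_trans beta_gt1.
  have : 0 < step beta (val u) a by rewrite uav; exact/state_gt0/valP.
  rewrite lt_min => /andP[_ h]; have u1 := state_le1 (valP u).
  have bb := archi_boundP (ltW b0).
  have : beta * val u <= beta by rewrite ler_piMr // ltW.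
  by move=> h'; rewrite -(@ltr_nat R); apply: le_lt_trans bb; lra.
have e_spec : step beta (val (u, Ordinal ab, v).1.1) (u, Ordinal ab, v).1.2 == val (u, Ordinal ab, v).2.
  by apply/eqP.
by exists (Sub (u, Ordinal ab, v) e_spec : state_edge).
Qed.

Lemma state_graph_right_resolving : right_resolving state_graph.
Proof.
move=> [[[u a] v] uv] [[[u' a'] v'] uv'] /= uu /ord_inj aa; apply: val_inj => /=.
have := eqP uv'; rewrite /= -uu -aa; have := eqP uv; rewrite /= => -> /val_inj -> //.
Qed.

Lemma state_graph_presents : presents state_graph (beta_shift beta).
Proof.
rewrite /presents eqEsubset; split=> [_ [e eS <-]|x /exists_max_states[s [xs _]]].
  apply: (@states_beta_shift _ (fun i => val (src (e i)))) => i.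
  by split; [exact: valP|rewrite -eS; apply/esym/eqP; exact: (valP (e i))].
have /choice[e eP] i : exists e : edge state_graph,
    [/\ val (src e) = s i, val (tgt e) = s (i + 1) & lab e = x i].
  have [] := @state_edge_exists (SeqSub (xs i).1) (SeqSub (xs (i + 1)).1) (x i).
    by rewrite /= (xs i).2.
  by move=> e [se te le]; exists e; rewrite se te.
exists e; last by apply/funext => i; have [] := eP i.
by move=> i; apply: val_inj; have [_ -> _] := eP i; have [-> _ _] := eP (i + 1).
Qed.

End States.

(** * Reading words along the essential vertices of a graph *)

Section Reading.
Variables (A : Type) (F : lgraph A).
Implicit Types (u v : vertex F) (e : int -> edge F).

(** An arbitrary presentation may have vertices on no biinfinite path. Reading is restricted to the
    others, so that what is read belongs to the shift. *)
Definition essential u : Prop := exists e, edge_shift F e /\ src (e 0) = u.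

Fixpoint reads u (w : seq A) v : Prop :=
  if w is a :: w' then
    exists f : edge F, [/\ src f = u, lab f = a, essential (tgt f) & reads (tgt f) w' v]
  else u = v.

Definition readable u w : Prop := exists v, reads u w v.

Lemma essential_path e i : edge_shift F e -> essential (src (e i)).
Proof.
move=> eS; exists (fun j => e (i + j)); split; last by rewrite addr0.
by move=> j; rewrite eS addrA.
Qed.

Lemma reads_path e i n : edge_shift F e ->
  reads (src (e i)) (word (covering_map F e) i n) (src (e (i + n%:Z))).
Proof.
move=> eS; elim: n i => [|n IH] i; first by rewrite addr0.
rewrite word_cons; exists (e i); rewrite eS; split=> //; first exact: essential_path.
by have := IH (i + 1); rewrite -addrA -PoszD add1n.
Qed.

Lemma reads_cat u w w' v :
  reads u (w ++ w') v <-> exists2 v', reads u w v' & reads v' w' v.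
Proof.
elim: w u => [|a w IH] u /=; first by split=> [h|[v' -> //]]; exists u.
split=> [[f [fu fa fe /IH[v' h1 h2]]]|[v' [f [fu fa fe h1]] h2]].
  by exists v' => //; exists f.
by exists f; split=> //; apply/IH; exists v'.
Qed.

Lemma readable_bifactor u w : essential u -> readable u w ->
  exists e, edge_shift F e /\ word (covering_map F e) 0 (size w) = w.
Proof.
move=> ue [v uwv].
suff [e [eS _ ew]] : exists e, [/\ edge_shift F e, src (e 0) = u &
    word (covering_map F e) 0 (size w) = w] by exists e.
elim: w u ue uwv => [|a w IH] u ue /=; first by case: ue => e [eS e0] _; exists e.
move=> [f [fu fa /IH fe /fe[e [eS e0 ew]]]]; have [e' [e'S e'0]] := ue.
(* The past of [e'], then the edge [f], then the path [e] delayed by one. *)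
exists (fun i => if i < 0 then e' i else if i == 0 then f else e (i - 1)).
split=> //; last first.
  rewrite word_cons; congr cons; rewrite // -{2}ew /word.
  apply: eq_map => j; rewrite /covering_map /=.
  by have -> : 0 + 1 + j%:Z - 1 = 0 + j%:Z by lia.
move=> i; have [i1|i1] := ltP i (-1).
  have -> : i < 0 by lia.
  by have -> : i + 1 < 0 by lia.
have [->|ni1] := eqVneq i (-1).
  by rewrite addNr /= e'S addNr e'0 fu.
have -> : (i < 0) = false by lia.
have -> : (i + 1 < 0) = false by lia.
have -> : (i + 1 == 0) = false by lia.
have [->|ni0] := eqVneq i 0; first by rewrite addrK e0.
by rewrite eS; congr (src (e _)); lia.
Qed.

Lemma reads_essential u w v : essential u -> reads u w v -> essential v.
Proof.
elim: w u => [|a w IH] u /= ue; first by move=> <-.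
by move=> [f [_ _ fe]]; exact: IH.
Qed.

Hypothesis rrF : right_resolving F.

Lemma reads_inj u w v v' : reads u w v -> reads u w v' -> v = v'.
Proof.
elim: w u => [|a w IH] u /=; first by move=> <- <-.
move=> [f [fu fa _ fv]] [g [gu ga _ gv]].
have fg : f = g by apply: rrF; rewrite ?fu ?fa.
by move: gv; rewrite -fg; exact: IH fv.
Qed.

Lemma readable_cons (f : edge F) w : essential (tgt f) ->
  readable (src f) (lab f :: w) <-> readable (tgt f) w.
Proof.
move=> fe; split=> [[v [g [gu ga _ gv]]]|[v fv]]; exists v; last by exists f.
by rewrite (rrF (esym gu) (esym ga)).
Qed.

End Reading.

(** * Identification of the Fischer cover with the orbit graph *)

Section FischerCover.
Variables (R : realType) (beta : R).
Hypothesis beta_gt1 : 1 < beta.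
Variable V : seq R.
Hypothesis orbP : forall r, r \in V <-> exists n, r = orb beta n.
Variable F : lgraph nat.
Hypothesis FX : presents F (beta_shift beta).
Hypothesis rrF : right_resolving F.

Implicit Types (u v : vertex F) (w : seq nat).

Lemma padded_word_beta_shift w : 0 < run beta 1 w ->
  beta_shift beta (fun i => if i is Posz n then nth 0%N w n else 0%N).
Proof.
move=> w0; pose s i := if i is Posz n then run beta 1 (mkseq (nth 0%N w) n) else 1.
have pos n : 0 < run beta 1 (mkseq (nth 0%N w) n).
  (* The prefix of length [n] of the padded word is extended to [w] followed by [n] zeros, and zeros
     preserve positivity. *)
  apply: (@run_gt0_catl _ _ beta_gt1 _ _ [seq nth 0%N w i | i <- iota n (size w)]).
  rewrite -map_cat -iotaD addnC iotaD map_cat add0n -/(mkseq _ _) mkseq_nth.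
  rewrite (_ : map _ _ = nseq n 0%N) ?run_cat ?run_nseq0_gt0 //.
  apply: (@eq_from_nth _ 0%N) => [|i]; rewrite size_map size_iota ?size_nseq // => ilt.
  by rewrite (nth_map 0%N) ?size_iota // nth_iota // nth_nseq ilt nth_default ?leq_addr.
apply: (@states_beta_shift _ _ beta_gt1 _ orbP _ s) => -[n|n] /=; split.
- by apply: run_state => //; exact: state1.
- by rewrite addn1 /mkseq -addn1 iotaD map_cat run_cat.
- exact: state1.
- have -> : Negz n + 1 = - n%:Z by lia.
  case: n => [|n] /=; rewrite /step mulr1 subr0 (min_idPl _) // ltW //.
Qed.

Lemma readable_run u w : essential u -> readable u w -> 0 < run beta 1 w.
Proof.
move=> ue /(readable_bifactor ue)[e [eS <-]]; apply: beta_shift_run => //.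
by rewrite -FX; exists e.
Qed.

Lemma run_readable w : 0 < run beta 1 w -> exists2 u : vertex F, essential u & readable u w.
Proof.
move=> /padded_word_beta_shift; set x := (fun i => _); rewrite -FX => -[e eS ex].
exists (src (e 0)); first exact: essential_path.
exists (src (e (0 + (size w)%:Z))).
have wE : word (covering_map F e) 0 (size w) = w.
  by rewrite ex -{2}(mkseq_nth 0%N w) /word /mkseq; apply: eq_map.
by rewrite -{1}wE; exact: reads_path.
Qed.

(* [u] has the follower set of the state [r]. *)
Definition represents u r : Prop :=
  essential u /\ forall w, readable u w <-> 0 < run beta r w.

(* Read a word of the language from a vertex, then return to the state 1. If
   the vertex reached does not read the whole language, the word can be
   continued so as to be readable from fewer vertices. *)
Lemma represents1 : exists u, represents u 1.
Proof.
(* Induction on the size of this set, which is nonempty for every word of the language. *)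
pose S w := [set u : vertex F | `[< essential u /\ readable u w >]]%SET.
suff H n w : (#|S w| <= n)%N -> 0 < run beta 1 w -> exists u, represents u 1.
  exact: (H _ [::] (leqnn _) ltr01).
elim: n w => [|n IH] w Sw w0.
  have [u ue uw] := run_readable w0.
  move: Sw; rewrite leqn0 cards_eq0 => /eqP/setP/(_ u).
  by rewrite !inE => /asboolPn; case.
have [u ue [v uv]] := run_readable w0.
have [//|nrep] := pselect (exists u, represents u 1).
suff [w' w'0 w'u] : exists2 w', 0 < run beta 1 (w ++ w') & ~ readable u (w ++ w').
  apply: (IH (w ++ w')) => //; rewrite -ltnS; apply: leq_trans Sw.
  apply/proper_card/properP; split.
    apply/fintype.subsetP => t; rewrite !inE => -[te [t' /reads_cat[t'' tw _]]].
    by split=> //; exists t''.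
  exists u; first by rewrite !inE; split=> //; exists v.
  by rewrite inE; apply/asboolPn => -[].
have [n0 n0E] : exists m, run beta (run beta 1 w) (nseq m 0%N) = 1.
  by apply: run_nseq0; rewrite // w0 run_le1.
have [[v1 vv1]|nv] := pselect (readable v (nseq n0 0%N)); last first.
  exists (nseq n0 0%N); first by rewrite run_cat n0E ltr01.
  move=> [t /reads_cat[v' uv' v't]]; apply: nv; exists t.
  by rewrite (reads_inj rrF uv uv').
have v1e : essential v1 by apply: reads_essential vv1; exact: reads_essential uv.
have [w1 w10 w1v] : exists2 w1, 0 < run beta 1 w1 & ~ readable v1 w1.
  apply: contrapT => nw; apply: nrep; exists v1; split=> // w1; split; first exact: readable_run.
  by move=> w10; apply: contrapT => nr; apply: nw; exists w1.
exists (nseq n0 0%N ++ w1); first by rewrite !run_cat n0E.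
move=> [t /reads_cat[v' uv' /reads_cat[v1' v'v1' v1't]]]; apply: w1v; exists t.
have E1 := reads_inj rrF uv uv'; rewrite -E1 in v'v1'.
by rewrite (reads_inj rrF vv1 v'v1').
Qed.

Lemma represents_tgt (f : edge F) r : essential (tgt f) -> represents (src f) r ->
  represents (tgt f) (step beta r (lab f)).
Proof. by move=> fe [_ fr]; split=> // w; rewrite -readable_cons // fr. Qed.

Lemma represents_edge u r a : represents u r -> 0 < step beta r a ->
  exists f : edge F, [/\ src f = u, lab f = a & represents (tgt f) (step beta r a)].
Proof.
move=> ur ra; have [v [f [fu fa fe _]]] : readable u [:: a] by apply/ur.2.
by exists f; split=> //; rewrite -fa; apply: represents_tgt; rewrite ?fu.
Qed.

(** From a vertex representing 1, follow the edges labelled by the quasi-greedy digits. *)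
Lemma represents_exists r : r \in V -> exists u, represents u r.
Proof.
move=> /orbP[n ->]; elim: n => [|n [u un]]; first exact: represents1.
have on0 := orb_gt0 beta_gt1 n; have stepE := step_qdigit beta_gt1 on0.
have st0 : 0 < step beta (orb beta n) (qdigit beta (orb beta n)).
  by rewrite stepE; exact: qstep_gt0.
by have [f [_ _ fn]] := represents_edge un st0; exists (tgt f); rewrite /orb iterS -stepE.
Qed.

Lemma represents_inj u r r' : r \in V -> r' \in V ->
  represents u r -> represents u r' -> r = r'.
Proof.
move=> rV r'V [_ ur] [_ ur']; apply: (separating_word beta_gt1).
- exact: (state_gt0 beta_gt1 orbP).
- exact: (state_gt0 beta_gt1 orbP).
- by move=> w; rewrite -ur ur'.
Qed.

Hypothesis minF : (#|vertex F| <= #|{: seq_sub V}|)%N.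

(** Distinct states have distinct follower sets, so a choice of representing vertices is injective,
    and [minF] makes it bijective. *)
Lemma vertex_of_state : exists f : seq_sub V -> vertex F,
  bijective f /\ forall r, represents (f r) (val r).
Proof.
have /choice[f fP] (r : seq_sub V) : exists u, represents u (val r).
  exact/represents_exists/valP.
exists f; split=> //; apply: inj_card_bij minF => r r' ff.
apply: val_inj; apply: (@represents_inj (f r)); [exact: valP|exact: valP|exact: fP|].
by rewrite ff; exact: fP.
Qed.

Lemma state_of_vertex : exists h : vertex F -> R, [/\ injective h,
  forall e, edge_shift F e -> states beta V (covering_map F e) (fun i => h (src (e i))) &
  forall x s, states beta V x s -> exists e,
    [/\ edge_shift F e, covering_map F e = x & forall i, h (src (e i)) = s i]].
Proof.
have [f [[g fK gK] fP]] := vertex_of_state.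
have gP u : represents u (val (g u)) by rewrite -{1}(gK u).
have gV u : val (g u) \in V by exact: valP.
exists (fun u => val (g u)); split=> [u v /val_inj/(can_inj gK) //|e eS i|x s xs].
  split; first exact: gV.
  have h := represents_tgt (gP (tgt (e i))).1 (gP (src (e i))).
  have h0 : 0 < run beta (val (g (src (e i)))) [:: lab (e i)].
    by apply/(h.2 [::]); exists (tgt (e i)).
  rewrite -eS; apply: represents_inj (gP _) h => //.
  exact: (run_state beta_gt1 orbP _ h0).
have /choice[e eP] i : exists d : edge F,
    [/\ src d = f (SeqSub (xs i).1), lab d = x i & represents (tgt d) (s (i + 1))].
  have s0 : 0 < step beta (s i) (x i).
    by rewrite -(xs i).2 (state_gt0 beta_gt1 orbP) // (xs _).1.
  have [d [? ? dP]] := represents_edge (fP (SeqSub (xs i).1)) s0.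
  by exists d; split=> //; move: dP; rewrite -(xs i).2.
exists e; split=> [i||i]; last by have [-> _ _] := eP i; rewrite fK.
  have [_ _ ti] := eP i; have [-> _ _] := eP (i + 1).
  rewrite -[LHS]gK; congr f; apply: val_inj.
  by apply: represents_inj (gP _) ti; [exact: gV|exact: (xs _).1].
by apply/funext => i; have [_ ? _] := eP i.
Qed.

End FischerCover.

(** * State sequences over a given point *)

Section Fibers.
Variables (R : realType) (beta : R).
Hypothesis beta_gt1 : 1 < beta.
Variable V : seq R.
Hypothesis orbP : forall r, r \in V <-> exists n, r = orb beta n.

Implicit Types (x : int -> nat) (s : int -> R).

Definition recurrent s : Prop := forall i, exists2 j, j <= i & s j = 1.

Lemma not_recurrent x s : states beta V x s -> ~ recurrent s ->
  exists i, forall j, j <= i -> s j < 1.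
Proof.
move=> xs nrec; apply: contrapT => nlt; apply: nrec => i.
apply: contrapT => n1; apply: nlt; exists i => j ji.
rewrite lt_neqAle (state_le1 beta_gt1 orbP (xs j).1) andbT; apply/eqP => s1.
by apply: n1; exists j.
Qed.

(** At an earlier visit to 1 the sequence [s] is as large as possible, and steps are monotone. *)
Lemma states_recurrent_ge x s s' : states beta V x s -> states beta V x s' ->
  recurrent s -> forall i, s' i <= s i.
Proof.
move=> xs xs' rs i; have [j ji sj] := rs i.
have [n ->] : exists n : nat, i = j + n%:Z by exists `|i - j|%N; lia.
rewrite -(run_states j n xs) -(run_states j n xs') run_le // sj.
exact: (state_le1 beta_gt1 orbP (xs' j).1).
Qed.

Lemma finite_away0 (W : seq R) :
  exists2 eps : R, 0 < eps & forall y, y \in W -> y != 0 -> eps <= `|y|.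
Proof.
elim: W => [|a W [eps e0 IH]]; first by exists 1.
have [a0|a0] := eqVneq a 0.
  by exists eps => // y; rewrite inE a0 => /orP[/eqP ->|/IH //]; rewrite eqxx.
exists (Num.min eps `|a|) => [|y]; first by rewrite lt_min e0 normr_gt0.
rewrite inE ge_min => /orP[/eqP -> _|/IH h /h -> //].
by rewrite lexx orbT.
Qed.

(* Away from the state 1 the states evolve by expanding affine maps, so two
   distinct ones would get arbitrarily close in the past; but the states are
   finitely many. *)
Lemma states_transient_eq x s s' : states beta V x s -> states beta V x s' ->
  ~ recurrent s -> ~ recurrent s' -> s = s'.
Proof.
move=> xs xs' /(not_recurrent xs)[M1 lt1] /(not_recurrent xs')[M2 lt2].
have diff M k : M <= M1 -> M <= M2 ->
    s M - s' M = beta ^+ k * (s (M - k%:Z) - s' (M - k%:Z)).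
  move=> h1 h2; elim: k => [|k IH]; first by rewrite subr0 mul1r.
  have Ek : M - k%:Z = M - k.+1%:Z + 1 by lia.
  have [_ E1] := xs (M - k.+1%:Z); have [_ E2] := xs' (M - k.+1%:Z).
  rewrite -Ek in E1 E2; rewrite IH.
  have s1 : step beta (s (M - k.+1%:Z)) (x (M - k.+1%:Z)) < 1 by rewrite -E1; apply: lt1; lia.
  have s2 : step beta (s' (M - k.+1%:Z)) (x (M - k.+1%:Z)) < 1 by rewrite -E2; apply: lt2; lia.
  move: (step_lt1E s1) (step_lt1E s2); rewrite -E1 -E2 => {}E1 {}E2.
  by rewrite [s (M - k%:Z)]E1 [s' (M - k%:Z)]E2 exprS; ring.
have eqM M : M <= M1 -> M <= M2 -> s M = s' M.
  move=> h1 h2; apply/eqP; rewrite -subr_eq0; apply/negPn/negP => d0.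
  have [eps e0 epsP] := finite_away0 [seq u - v | u <- V, v <- V].
  have [k] := ltr_exp_unbounded beta_gt1 eps^-1; rewrite -(ltr_pM2r e0) mulVf ?gt_eqF //.
  rewrite ltNge => /negP; apply.
  have bk0 : 0 < beta ^+ k by rewrite exprn_gt0 // (lt_trans _ beta_gt1).
  have dk0 : s (M - k%:Z) - s' (M - k%:Z) != 0.
    by apply: contraNneq d0 => dk; rewrite (diff M k h1 h2) dk mulr0.
  apply: (@le_trans _ _ `|s M - s' M|).
    rewrite (diff M k h1 h2) normrM (gtr0_norm bk0) ler_pM2l //.
    by apply: epsP dk0; apply: allpairs_f; [exact: (xs _).1|exact: (xs' _).1].
  have := state_gt0 beta_gt1 orbP (xs M).1; have := state_le1 beta_gt1 orbP (xs M).1.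
  have := state_gt0 beta_gt1 orbP (xs' M).1; have := state_le1 beta_gt1 orbP (xs' M).1.
  by rewrite ler_norml; lra.
(* Equality far in the past propagates forward, since states evolve deterministically. *)
apply/funext => i; pose M := Num.min i (Num.min M1 M2).
have [Mi M1M M2M] : [/\ M <= i, M <= M1 & M <= M2] by rewrite /M; split; lia.
have [n ->] : exists n : nat, i = M + n%:Z by exists `|i - M|%N; lia.
by rewrite -(run_states M n xs) -(run_states M n xs') eqM.
Qed.

Lemma states_recurrent_eq x s s' : states beta V x s -> states beta V x s' ->
  recurrent s -> recurrent s' -> s = s'.
Proof.
move=> xs xs' rs rs'; apply/funext => i; apply/eqP; rewrite eq_le.
by rewrite (states_recurrent_ge xs xs' rs) (states_recurrent_ge xs' xs rs').
Qed.

(** As long as it avoids 1, a state sequence follows the orbit, which is at 1 at every multiple of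
    [p]. *)
Lemma periodic_recurrent p x s : (0 < p)%N -> orb beta p = 1 ->
  states beta V x s -> recurrent s.
Proof.
move=> p0 orbp xs; apply: contrapT => /(not_recurrent xs)[M lt1].
have [n sn] := (orbP _).1 (xs (M - p%:Z)).1.
have Es m : (m <= p)%N -> s (M - p%:Z + m%:Z) = orb beta (n + m).
  elim: m => [|m IH] mp; first by rewrite addr0 addn0.
  have Em : M - p%:Z + m.+1%:Z = M - p%:Z + m%:Z + 1 by lia.
  have sE := (xs (M - p%:Z + m%:Z)).2.
  have pos i := state_gt0 beta_gt1 orbP (xs i).1.
  rewrite Em sE (step_lt1_qstep beta_gt1) ?pos -?sE ?pos //.
    by rewrite IH ?addnS //; exact: ltnW.
  by apply: lt1; lia.
have orbpM q : orb beta (q * p) = 1.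
  by elim: q => // q IH; rewrite mulSn orbD IH.
have /lt1 : M - p%:Z + (p - n %% p)%N%:Z <= M by lia.
rewrite Es ?leq_subr // {1}(divn_eq n p) -addnA subnKC ?orbpM ?ltxx //.
  by rewrite -mulSnr orbpM ltxx.
by rewrite ltnW // ltn_mod.
Qed.

(** A step is strictly increasing where it is not cut, and where it is cut its value 1 still exceeds
    every [s i]. *)
Lemma run1_gt_states x s i n : states beta V x s -> (forall i, s i < 1) ->
  s (i + n%:Z) < run beta 1 (word x i n).
Proof.
move=> xs lt1; elim: n => [|n IH]; first by rewrite addr0.
have En : i + n.+1%:Z = i + n%:Z + 1 by lia.
rewrite wordS run_rcons {1}/step lt_min {1}En lt1 /=.
rewrite En (xs _).2 step_lt1E -?(xs _).2 // ltrD2r ltr_pM2l //.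
exact: lt_trans beta_gt1.
Qed.

Lemma two_states N p : (0 < p)%N ->
  (forall n, (N <= n)%N -> orb beta (n + p) = orb beta n) ->
  (forall n, (0 < n)%N -> orb beta n <> 1) ->
  exists x s s', [/\ states beta V x s, states beta V x s' & s <> s'].
Proof.
move=> p0 orbp orb1.
have orb_mod k : orb beta (N.+1 + k %% p) = orb beta (N.+1 + k).
  have -> : (N.+1 + k = N.+1 + k %% p + k %/ p * p)%N by have := divn_eq k p; lia.
  elim: (k %/ p)%N => [|q IH]; first by rewrite addn0.
  by rewrite mulSnr addnA orbp //; lia.
(* The periodic tail of the orbit, extended to both sides. Starting at [N.+1] keeps every index
   positive, as [orb1] requires. *)
pose s i := orb beta (N.+1 + `|(i %% p)%Z|%N).
have sS i : s (i + 1) = qstep beta (s i).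
  rewrite /s -modzDml; have := modz_ge0 i (_ : p%:Z != 0).
  case: (i %% p)%Z => [k _|k /(_ _)]; last by lia.
  by rewrite -PoszD modz_nat orb_mod addn1 addnS.
have xs : states beta V (fun i => qdigit beta (s i)) s.
  move=> i; split; first by apply/orbP; eexists.
  by rewrite sS step_qdigit //; exact: orb_gt0.
have lt1 i : s i < 1.
  by rewrite lt_neqAle orb_le1 // andbT; apply/eqP/orb1.
have [s' [xs' s'E]] := exists_max_states beta_gt1 orbP (states_beta_shift beta_gt1 orbP xs).
exists (fun i => qdigit beta (s i)), s, s'; split=> // ss'.
have [m] := s'E 0; have := run1_gt_states (0 - m%:Z) m xs lt1.
by rewrite subrK -ss' => /[swap] <-; rewrite ltxx.
Qed.

End Fibers.

(** * Cardinalities of small fibers *)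

Section Counting.
Variables (R : realType) (T : choiceType).
Implicit Types (A : set T) (a b : T).
Local Open Scope classical_set_scope.

Lemma counting1 a : counting [set a] = 1%:E :> \bar R.
Proof. by rewrite /counting asboolT ?fset_set1 ?finmap.cardfs1. Qed.

Lemma counting2 a b : a <> b -> counting [set a; b] = 2%:E :> \bar R.
Proof.
move=> /eqP ab; rewrite /counting asboolT // fset_setU // !fset_set1.
by rewrite finmap.cardfs2 ab.
Qed.

Lemma counting_le2 A : (forall a b c, A a -> A b -> A c -> [\/ a = b, a = c | b = c]) ->
  (counting A <= 2%:E :> \bar R)%E.
Proof.
move=> A3; have [->|/set0P[a Aa]] := eqVneq A set0.
  by rewrite /counting asboolT // fset_set0 finmap.cardfs0 lee_fin.
have [[b [Ab ba]]|nb] := pselect (exists b, A b /\ b <> a).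
  suff -> : A = [set a; b] by rewrite counting2 //; exact: nesym.
  apply/seteqP; split=> [c Ac|c [->|->] //].
  by case: (A3 a b c Aa Ab Ac) => [/esym//|->|->]; [left|right].
suff -> : A = [set a] by rewrite counting1 lee_fin ler1n.
apply/seteqP; split=> [c Ac|c -> //].
by apply: contrapT => ca; apply: nb; exists c.
Qed.

Lemma m_to_oneP (U : Type) (f : T -> U) (D : set T) (X : set U) (m : nat) x :
  X x -> counting (D `&` f @^-1` [set x]) = m%:R%:E :> \bar R ->
  (forall y, X y -> (counting (D `&` f @^-1` [set y]) <= m%:R%:E :> \bar R)%E) ->
  m_to_one R f D X m.
Proof.
move=> Xx xm le; apply/eqP; rewrite eq_le; apply/andP; split.
  by apply: ge_ereal_sup => _ [y Xy <-]; exact: le.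
by rewrite -xm; apply: ereal_sup_ubound; exists x.
Qed.

End Counting.

(** * The covering map in the periodic and nonperiodic cases *)

Section Main.
Variables (R : realType) (beta : R).
Hypothesis beta_gt1 : 1 < beta.
Variables (N p : nat).
Hypothesis p_gt0 : (0 < p)%N.
Hypothesis orb_per : forall n, (N <= n)%N -> orb beta (n + p) = orb beta n.

Let V : seq R := [seq orb beta i | i <- iota 0 (N + p)].

Lemma mem_orbit r : r \in V <-> exists n, r = orb beta n.
Proof.
split=> [/mapP[n _ ->]|[n ->]]; first by exists n.
elim/ltn_ind: n => n IH; have [lt|ge] := ltnP n (N + p).
  by apply: map_f; rewrite mem_iota.
rewrite -(subnK (leq_trans (leq_addl N p) ge)) orb_per; last by lia.
by apply: IH; lia.
Qed.

Variable F : lgraph nat.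
Hypothesis hF : right_Fischer_cover F (beta_shift beta).

Local Notation fiber x := (edge_shift F `&` covering_map F @^-1` [set x])%classic.

(** Counting a fiber thus becomes counting the state sequences over its point. Minimality is applied
    against [state_graph]. *)
Lemma fiber_states : exists h : vertex F -> R, [/\
  forall x e, fiber x e -> states beta V x (fun i => h (src (e i))),
  forall x e e', fiber x e -> fiber x e' ->
    (fun i => h (src (e i))) = (fun i => h (src (e' i))) -> e = e' &
  forall x s, states beta V x s ->
    exists e, fiber x e /\ (fun i => h (src (e i))) = s].
Proof.
have [FX rrF minF] := hF.
have minV : (#|vertex F| <= #|{: seq_sub V}|)%N.
  by apply: (minF (state_graph beta V)) => //;
    [exact: state_graph_presents mem_orbit|exact: state_graph_right_resolving].
have [h [hinj hst hex]] := state_of_vertex beta_gt1 mem_orbit FX rrF minV.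
exists h; split=> [x e [eS <-]|x e e' [_ ex] [_ e'x] hh|x s /hex[e [eS ex es]]].
- exact: hst.
- apply/funext => i; apply: rrF; first by apply: hinj; exact: (congr1 (@^~ i) hh).
  by rewrite -/(covering_map F e i) ex -e'x.
- by exists e; split; [split|exact/funext].
Qed.

Lemma m_to_one_periodic : (exists2 q, (0 < q)%N & orb beta q = 1) ->
  m_to_one R (covering_map F) (edge_shift F) (beta_shift beta) 1.
Proof.
move=> [q q0 orbq]; have [h [hst hinj _]] := fiber_states.
have [FX _ _] := hF.
have f1 x : beta_shift beta x -> counting (fiber x) = 1%:E :> \bar R.
  rewrite -{1}FX => -[e eS ex].
  suff -> : fiber x = [set e]%classic by exact: counting1.
  apply/seteqP; split=> [e' e'x|_ ->] //.
  have xe : fiber x e by [].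
  apply: (hinj _ _ _ e'x xe).
  have rec d : fiber x d -> recurrent (fun i => h (src (d i))).
    by move=> dx; exact: (periodic_recurrent beta_gt1 mem_orbit q0 orbq (hst _ _ dx)).
  exact: (states_recurrent_eq beta_gt1 mem_orbit (hst _ _ e'x) (hst _ _ xe) (rec _ e'x) (rec _ xe)).
have [x Xx] : exists x, beta_shift beta x.
  by eexists; exact: (padded_word_beta_shift beta_gt1 mem_orbit (w := [::]) ltr01).
by apply: (m_to_oneP Xx); [exact: f1|move=> y Xy; rewrite f1].
Qed.

Lemma m_to_one_nonperiodic : (forall n, (0 < n)%N -> orb beta n <> 1) ->
  m_to_one R (covering_map F) (edge_shift F) (beta_shift beta) 2.
Proof.
move=> orb1; have [h [hst hinj hex]] := fiber_states.
have fiber3 x a b c : fiber x a -> fiber x b -> fiber x c -> [\/ a = b, a = c | b = c].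
  move=> ax bx cx.
  pose st (e : int -> edge F) (i : int) := h (src (e i)).
  have rr e e' : fiber x e -> fiber x e' -> recurrent (st e) -> recurrent (st e') -> e = e'.
    move=> ex e'x r r'; apply: (hinj _ _ _ ex e'x).
    exact: (states_recurrent_eq beta_gt1 mem_orbit (hst _ _ ex) (hst _ _ e'x) r r').
  have tt e e' : fiber x e -> fiber x e' -> ~ recurrent (st e) -> ~ recurrent (st e') -> e = e'.
    move=> ex e'x r r'; apply: (hinj _ _ _ ex e'x).
    exact: (states_transient_eq beta_gt1 mem_orbit (hst _ _ ex) (hst _ _ e'x) r r').
  (* Among three paths, two are both recurrent or both not, and these coincide. *)
  have [ra|ra] := pselect (recurrent (st a)); have [rb|rb] := pselect (recurrent (st b));
  have [rc|rc] := pselect (recurrent (st c));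
    by [apply: Or31; auto|apply: Or32; auto|apply: Or33; auto].
have [x [s [s' [xs xs' ss']]]] := two_states beta_gt1 mem_orbit p_gt0 orb_per orb1.
have [e [ex es]] := hex _ _ xs; have [e' [e'x es']] := hex _ _ xs'.
have ee' : e <> e' by move=> E; apply: ss'; rewrite -es -es' E.
apply: (@m_to_oneP _ _ _ _ _ _ _ x) => [||y _]; last exact: counting_le2 (@fiber3 y).
  exact: (states_beta_shift beta_gt1 mem_orbit xs).
suff -> : fiber x = [set e; e']%classic by exact: counting2.
apply/seteqP; split=> [c cx|_ [->|->] //].
by case: (fiber3 x e e' c ex e'x cx) => [//|->|->]; [left|right].
Qed.

End Main.

Theorem proposition4p7 (R : realType) (beta : R) (hbeta : 1 < beta)
    (hg : eventually_periodic_seq (generating_seq beta))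
    (F : lgraph nat) (hF : right_Fischer_cover F (beta_shift beta)) :
  (periodic_seq (generating_seq beta) ->
     m_to_one R (covering_map F) (edge_shift F) (beta_shift beta) 1) /\
  (~ periodic_seq (generating_seq beta) ->
     m_to_one R (covering_map F) (edge_shift F) (beta_shift beta) 2).
Proof.
have [N [p p0 gp]] := hg.
have orbp := orb_eventually_periodic hbeta gp.
split=> [[q q0 gq]|npg].
  apply: (m_to_one_periodic hbeta p0 orbp hF); exists q => //.
  (* Periodicity from index 0 on brings the orbit back to its start, 1. *)
  by rewrite (orb_eventually_periodic hbeta (N := 0) (p := q) (fun n _ => gq n) (n := 0)).
apply: (m_to_one_nonperiodic hbeta p0 orbp hF) => n n0 orbn; apply: npg.
(* A return of the orbit to 1 at time [n] would make the digits periodic with period [n]. *)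
by exists n => // k; rewrite !generating_seqE // orbD orbn.
Qed.
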